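(* Let $G\in\mathbb{GS}$ and $\ell\in\mathbb{R}$. Then $G\geqslant\ell$ (in the universe $\mathbb{GS}$) if and only if $G$ is left-$\ell$-protected.
   Context: Scoring games: an atom $\emptyset^s$ ($s\in\mathbb R$) is an empty set of options carrying score $s$; $\mathbb{S}$ consists of all games $\langle\mathcal G\mid\mathcal H\rangle$ built recursively, each side being a nonempty finite set of previously built games or a single atom (day 0: $\langle\emptyset^\ell\mid\emptyset^r\rangle$). A follower of $G$ is any game reachable by a (possibly empty, not necessarily alternating) sequence of moves. The number $\ell$ denotes $\langle\emptyset^\ell\mid\emptyset^\ell\rangle$. Disjunctive sum $G+H$: if $G=\langle\emptyset^{\ell_1}\mid\emptyset^{r_1}\rangle,H=\langle\emptyset^{\ell_2}\mid\emptyset^{r_2}\rangle$ then $G+H=\langle\emptyset^{\ell_1+\ell_2}\mid\emptyset^{r_1+r_2}\rangle$; otherwise Left options are all $G^L+H$, $G+H^L$, and if there are none the Left side is the atom whose score is the sum of the Left atoms of $G$ and $H$; symmetrically for Right. $Ls(G)=\ell$ if $G^{\mathcal L}=\emptyset^\ell$, else $\max_{G^L}Rs(G^L)$; $Rs(G)=r$ if $G^{\mathcal R}=\emptyset^r$, else $\min_{G^R}Ls(G^R)$. Conjugate $\sim\!G$: swap roles of Left and Right recursively, negating atoms. A game is atomic if one of its sides is an atom; an atomic game $G$ is guaranteed if $s\leqslant t$ for every atom $\emptyset^s$ on Left's side (the Left atom of $G$ or any atom in a follower of a Left option of $G$) and every atom $\emptyset^t$ on Right's side (the Right atom or any atom in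 a follower of a Right option). $\mathbb{GS}$ is the set of games all of whose atomic followers are guaranteed; it is closed under sums, options and conjugation. For $G,H\in\mathbb{GS}$, $G\geqslant H$ means $Ls(G+X)\geqslant Ls(H+X)$ and $Rs(G+X)\geqslant Rs(H+X)$ for all $X\in\mathbb{GS}$. Waiting moves: $\lceil0\rceil=\langle\emptyset^0\mid\emptyset^0\rangle$, $\lceil n\rceil=\langle\lceil n-1\rceil\mid\emptyset^0\rangle$ for $n\geqslant1$, $-\lceil n\rceil=\sim\!\lceil n\rceil$. Pass-allowed Left-score: $\underline{Ls}(G)=\min\{Ls(G-\lceil n\rceil):n\in\mathbb N_0\}$. $G$ is left-$\ell$-protected if $\underline{Ls}(G)\geqslant\ell$ and for every Right option $G^R$ of $G$ there exists a Left option $G^{RL}$ of $G^R$ that is left-$\ell$-protected (recursive definition; in particular every Right option must have a Left option). *)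

(* Defs.v *)
From Stdlib Require Import Reals List Lra Classical ClassicalEpsilon.
Import ListNotations.
Open Scope R_scope.

(* A nonempty finite set of options is represented by a nonempty list
   (first element, remaining elements); order and repetitions play no role in
   any of the notions below. *)
Inductive game : Type :=
| Game : side -> side -> game
with side : Type :=
| Atom : R -> side
| Opts : game -> list game -> side.

Definition lside (G : game) : side := let (GL, _) := G in GL.
Definition rside (G : game) : side := let (_, GR) := G in GR.

Definition options (S : side) : list game :=
  match S with Atom _ => [] | Opts g gs => g :: gs end.

Definition lopts (G : game) : list game := options (lside G).
Definition ropts (G : game) : list game := options (rside G).

Definition num_game (l : R) : game := Game (Atom l) (Atom l).

(* One side of G + H: [addH] is (fun G' => G' + H), [addG] is
   (fun H' => G + H'). *)
Definition add_side (addH addG : game -> game) (S T : side) : side :=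
  match S, T with
  | Atom s, Atom t => Atom (s + t)
  | Atom _, Opts h hs => Opts (addG h) (map addG hs)
  | Opts g gs, Atom _ => Opts (addH g) (map addH gs)
  | Opts g gs, Opts h hs =>
      Opts (addH g) (map addH gs ++ addG h :: map addG hs)
  end.

Fixpoint add_game (G : game) : game -> game :=
  fix addG (H : game) : game :=
    match G, H with
    | Game GL GR, Game HL HR =>
        Game (add_side (fun G' => add_game G' H) addG GL HL)
             (add_side (fun G' => add_game G' H) addG GR HR)
    end.

Fixpoint conj_game (G : game) : game :=
  match G with
  | Game GL GR => Game (conj_side GR) (conj_side GL)
  end
with conj_side (S : side) : side :=
  match S with
  | Atom s => Atom (- s)
  | Opts g gs => Opts (conj_game g) (map conj_game gs)
  end.

Fixpoint Ls (G : game) : R :=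
  match G with
  | Game (Atom l) _ => l
  | Game (Opts g gs) _ => fold_right (fun h m => Rmax (Rs h) m) (Rs g) gs
  end
with Rs (G : game) : R :=
  match G with
  | Game _ (Atom r) => r
  | Game _ (Opts g gs) => fold_right (fun h m => Rmin (Ls h) m) (Ls g) gs
  end.

Inductive follower (G : game) : game -> Prop :=
| follower_refl : follower G G
| follower_left : forall H K, follower G H -> In K (lopts H) -> follower G K
| follower_right : forall H K, follower G H -> In K (ropts H) -> follower G K.

Definition has_atom (G : game) (s : R) : Prop :=
  lside G = Atom s \/ rside G = Atom s.

Definition atom_on_left (G : game) (s : R) : Prop :=
  lside G = Atom s \/
  exists GL K, In GL (lopts G) /\ follower GL K /\ has_atom K s.

Definition atom_on_right (G : game) (t : R) : Prop :=
  rside G = Atom t \/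
  exists GR K, In GR (ropts G) /\ follower GR K /\ has_atom K t.

Definition atomic (G : game) : Prop := exists s, has_atom G s.

Definition guaranteed (G : game) : Prop :=
  forall s t, atom_on_left G s -> atom_on_right G t -> s <= t.

Definition GS (G : game) : Prop :=
  forall K, follower G K -> atomic K -> guaranteed K.

Definition game_ge (G H : game) : Prop :=
  forall X, GS X ->
    Ls (add_game G X) >= Ls (add_game H X) /\ Rs (add_game G X) >= Rs (add_game H X).

Fixpoint waiting (n : nat) : game :=
  match n with
  | O => Game (Atom 0) (Atom 0)
  | S m => Game (Opts (waiting m) []) (Atom 0)
  end.

Definition is_min (E : R -> Prop) (m : R) : Prop :=
  E m /\ forall x, E x -> m <= x.

Definition pass_scores (G : game) (x : R) : Prop :=
  exists n : nat, x = Ls (add_game G (conj_game (waiting n))).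

(* The minimum exists for every G: see [pass_Ls_is_min]. *)
Definition pass_Ls (G : game) : R :=
  epsilon (inhabits 0) (is_min (pass_scores G)).

(* Games are well-founded, so the least predicate closed under this rule is the
   one defined by recursion on G. *)
Inductive left_protected (l : R) (G : game) : Prop :=
| left_protected_intro :
    pass_Ls G >= l ->
    (forall GR, In GR (ropts G) ->
       exists GRL, In GRL (lopts GR) /\ left_protected l GRL) ->
    left_protected l G.

Lemma game_opts_ind (P : game -> Prop) :
  (forall G, (forall K, In K (lopts G) -> P K) ->
             (forall K, In K (ropts G) -> P K) -> P G) ->
  forall G, P G.
Proof.
  intros step.
  refine (fix IH (G : game) : P G := _).
  destruct G as [SL SR]; apply step; unfold lopts, ropts; simpl.
  - destruct SL as [s | g gs]; simpl; [intros K [] |].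
    intros K [HK | HK]; [rewrite <- HK; exact (IH g) |].
    revert K HK; induction gs as [| k gs IHgs]; simpl; [intros K [] |].
    intros K [HK | HK]; [rewrite <- HK; exact (IH k) | exact (IHgs K HK)].
  - destruct SR as [s | g gs]; simpl; [intros K [] |].
    intros K [HK | HK]; [rewrite <- HK; exact (IH g) |].
    revert K HK; induction gs as [| k gs IHgs]; simpl; [intros K [] |].
    intros K [HK | HK]; [rewrite <- HK; exact (IH k) | exact (IHgs K HK)].
Qed.

Lemma fold_Rmax_In (f : game -> R) (g : game) (gs : list game) :
  exists h, In h (g :: gs) /\ fold_right (fun h m => Rmax (f h) m) (f g) gs = f h.
Proof.
  induction gs as [| k gs (h & Hh & E)]; simpl in *.
  - exists g; auto.
  - rewrite E; unfold Rmax; destruct (Rle_dec (f k) (f h)).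
    + exists h; tauto.
    + exists k; tauto.
Qed.

Lemma fold_Rmin_In (f : game -> R) (g : game) (gs : list game) :
  exists h, In h (g :: gs) /\ fold_right (fun h m => Rmin (f h) m) (f g) gs = f h.
Proof.
  induction gs as [| k gs (h & Hh & E)]; simpl in *.
  - exists g; auto.
  - rewrite E; unfold Rmin; destruct (Rle_dec (f k) (f h)).
    + exists k; tauto.
    + exists h; tauto.
Qed.

Lemma Ls_cases (G : game) :
  lside G = Atom (Ls G) \/ exists K, In K (lopts G) /\ Ls G = Rs K.
Proof.
  destruct G as [[l | g gs] SR]; simpl; [now left | right].
  apply fold_Rmax_In.
Qed.

Lemma Rs_cases (G : game) :
  rside G = Atom (Rs G) \/ exists K, In K (ropts G) /\ Rs G = Ls K.
Proof.
  destruct G as [SL [r | g gs]]; simpl; [now left | right].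
  apply fold_Rmin_In.
Qed.

Lemma lopts_add (G H K : game) :
  In K (lopts (add_game G H)) ->
  (exists G', In G' (lopts G) /\ K = add_game G' H) \/
  (exists H', In H' (lopts H) /\ K = add_game G H').
Proof.
  destruct G as [[a | g gs] SR], H as [[b | h hs] TR]; unfold lopts;
    cbn -[In]; fold add_game; rewrite ?in_app_iff; cbn; rewrite ?in_app_iff; cbn;
    rewrite ?in_map_iff; intros HK.
  - easy.
  - right; destruct HK as [<- | (x & <- & Hx)]; eauto.
  - left; destruct HK as [<- | (x & <- & Hx)]; eauto.
  - destruct HK as [<- | [(x & <- & Hx) | [<- | (x & <- & Hx)]]];
      [left | left | right | right]; eauto.
Qed.

Lemma ropts_add (G H K : game) :
  In K (ropts (add_game G H)) ->
  (exists G', In G' (ropts G) /\ K = add_game G' H) \/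
  (exists H', In H' (ropts H) /\ K = add_game G H').
Proof.
  destruct G as [SL [a | g gs]], H as [TL [b | h hs]]; unfold ropts;
    cbn -[In]; fold add_game; rewrite ?in_app_iff; cbn; rewrite ?in_app_iff; cbn;
    rewrite ?in_map_iff; intros HK.
  - easy.
  - right; destruct HK as [<- | (x & <- & Hx)]; eauto.
  - left; destruct HK as [<- | (x & <- & Hx)]; eauto.
  - destruct HK as [<- | [(x & <- & Hx) | [<- | (x & <- & Hx)]]];
      [left | left | right | right]; eauto.
Qed.

Lemma lside_add_atom (G H : game) (u : R) :
  lside (add_game G H) = Atom u ->
  exists s t, lside G = Atom s /\ lside H = Atom t /\ u = s + t.
Proof.
  destruct G as [[a | g gs] SR], H as [[b | h hs] TR]; simpl; try discriminate.
  intros E; injection E as <-; eauto.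
Qed.

Lemma rside_add_atom (G H : game) (u : R) :
  rside (add_game G H) = Atom u ->
  exists s t, rside G = Atom s /\ rside H = Atom t /\ u = s + t.
Proof.
  destruct G as [SL [a | g gs]], H as [TL [b | h hs]]; simpl; try discriminate.
  intros E; injection E as <-; eauto.
Qed.

Lemma pass_scores_finite (G : game) :
  exists A : list R, forall n,
    In (Ls (add_game G (conj_game (waiting n)))) A /\
    In (Rs (add_game G (conj_game (waiting n)))) A.
Proof.
  induction G as [G IHL IHR] using game_opts_ind.
  assert (gather : forall gs : list game,
    (forall K, In K gs -> exists A : list R, forall n,
       In (Ls (add_game K (conj_game (waiting n)))) A /\
       In (Rs (add_game K (conj_game (waiting n)))) A) ->
    exists A : list R, forall K, In K gs -> forall n,
       In (Ls (add_game K (conj_game (waiting n)))) A /\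
       In (Rs (add_game K (conj_game (waiting n)))) A).
  { induction gs as [| g gs IHgs]; intros H.
    - exists []; easy.
    - destruct IHgs as [A HA]; [intros; apply H; now right |].
      destruct (H g) as [B HB]; [now left |].
      exists (B ++ A); intros K [<- | HK] n; rewrite !in_app_iff.
      + destruct (HB n); tauto.
      + destruct (HA K HK n); tauto. }
  destruct (gather _ IHL) as [AL HL], (gather _ IHR) as [AR HR].
  set (a := match lside G with Atom s => s | _ => 0 end).
  set (b := match rside G with Atom s => s | _ => 0 end).
  exists ((a :: b :: nil) ++ AL ++ AR).
  assert (Llow : forall n, In (Ls (add_game G (conj_game (waiting n))))
                              ((a :: b :: nil) ++ AL ++ AR)).
  { intros n; rewrite !in_app_iff.
    destruct (Ls_cases (add_game G (conj_game (waiting n)))) as [E | (K & HK & E)].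
    - apply lside_add_atom in E as (s & t & Es & Et & ->).
      left; left; unfold a; rewrite Es.
      assert (t = - 0) by (destruct n; simpl in Et; congruence); lra.
    - rewrite E; apply lopts_add in HK as [(G' & HG' & ->) | (H' & HH' & ->)].
      + right; left; now apply HL.
      + destruct n; easy. }
  intros n; split; [apply Llow |].
  destruct (Rs_cases (add_game G (conj_game (waiting n)))) as [E | (K & HK & E)].
  - apply rside_add_atom in E as (s & t & Es & Et & ->).
    right; left; unfold b; rewrite Es.
    assert (t = - 0) by (destruct n; simpl in Et; congruence); lra.
  - rewrite E; apply ropts_add in HK as [(G' & HG' & ->) | (H' & HH' & ->)].
    + rewrite !in_app_iff; right; right; now apply HR.
    + destruct n as [| n]; [easy |].
      destruct HH' as [<- | []]; apply Llow.
Qed.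

Lemma finite_is_min (A : list R) (E : R -> Prop) :
  (exists x, E x) -> (forall x, E x -> In x A) -> exists m, is_min E m.
Proof.
  revert E; induction A as [| a A IH]; intros E [x Ex] HA.
  - destruct (HA x Ex).
  - destruct (classic (exists y, E y /\ y <> a)) as [Hy | Hy].
    + destruct (IH (fun y => E y /\ y <> a) Hy) as (m & [Em _] & Hm).
      { intros y [Ey Hya]; destruct (HA y Ey); [congruence | easy]. }
      destruct (classic (E a /\ a <= m)) as [[Ea Ham] | Ha].
      * exists a; split; [easy |]; intros y Ey.
        destruct (Req_dec y a) as [-> | Hya]; [lra |].
        specialize (Hm y (conj Ey Hya)); lra.
      * exists m; split; [easy |]; intros y Ey.
        destruct (Req_dec y a) as [-> | Hya]; [| now apply Hm].
        destruct (Rle_dec a m); [tauto | lra].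
    + assert (Ha : forall y, E y -> y = a).
      { intros y Ey; apply NNPP; intros Hya; apply Hy; eauto. }
      exists a; split.
      * now rewrite <- (Ha x Ex).
      * intros y Ey; rewrite (Ha y Ey); lra.
Qed.

Lemma pass_Ls_is_min (G : game) : is_min (pass_scores G) (pass_Ls G).
Proof.
  unfold pass_Ls; apply (epsilon_spec (inhabits 0) (is_min (pass_scores G))).
  destruct (pass_scores_finite G) as [A HA].
  apply (finite_is_min A).
  - exists (Ls (add_game G (conj_game (waiting 0)))); now exists 0%nat.
  - intros x [n ->]; apply HA.
Qed.

(* Main.v *)
(* If G is protected, Left answers every Right move in G by a protected
   position and otherwise copies an optimal line of play in X; the only position
   where Left lacks a move to copy has a Left atom in X, and there every
   remaining atom of X is at least that one, so X is worth no more to Right than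
   a long enough stock of waiting moves, against which the pass-allowed score
   protects Left.
   Conversely, if no answer to some G^R is >= l, each answer has a game X_i in
   which it is strictly worse than l with Left to move.  Normalising these to
   Ls X_i = -l and offering them all to Right, with a hopeless Left option,
   yields a game distinguishing G from l. *)
Require Import Defs.
From Stdlib Require Import Reals List Lra Lia Classical.
Import ListNotations.
Open Scope R_scope.

(** Protection descends from G to some G^RL, two moves at once. Carrying the claim for G together
    with its Left options lets ordinary induction on options reach those positions. *)
Lemma game_rl_ind (P : game -> Prop) :
  (forall G, (forall GR GRL, In GR (ropts G) -> In GRL (lopts GR) -> P GRL) ->
             P G) ->
  forall G, P G.
Proof.
  intros step G.
  enough (P G /\ forall K, In K (lopts G) -> P K) by tauto.
  induction G as [G IHL IHR] using game_opts_ind; split.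
  - apply step; intros GR GRL HR HL; now apply (IHR GR HR).
  - intros K HK; now apply IHL.
Qed.

Lemma exists_upper_bound (f : game -> R) (gs : list game) :
  exists B, forall K, In K gs -> f K <= B.
Proof.
  induction gs as [| g gs [B HB]].
  - now exists 0.
  - exists (Rmax (f g) B); intros K [<- | HK].
    + apply Rmax_l.
    + apply Rle_trans with B; [now apply HB | apply Rmax_r].
Qed.

(** * Scores *)

Lemma Rs_le_Ls (G K : game) : In K (lopts G) -> Rs K <= Ls G.
Proof.
  destruct G as [[l | g gs] SR]; unfold lopts; simpl; [easy |].
  induction gs as [| h gs IH]; simpl.
  - intros [-> | []]; lra.
  - intros [-> | [-> | HK]].
    + eapply Rle_trans; [apply IH; now left | apply Rmax_r].
    + apply Rmax_l.
    + eapply Rle_trans; [apply IH; now right | apply Rmax_r].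
Qed.

Lemma Rs_le_Ls_right (G K : game) : In K (ropts G) -> Rs G <= Ls K.
Proof.
  destruct G as [SL [l | g gs]]; unfold ropts; simpl; [easy |].
  induction gs as [| h gs IH]; simpl.
  - intros [-> | []]; lra.
  - intros [-> | [-> | HK]].
    + eapply Rle_trans; [apply Rmin_r | apply IH; now left].
    + apply Rmin_l.
    + eapply Rle_trans; [apply Rmin_r | apply IH; now right].
Qed.

Lemma Ls_atom (G : game) (s : R) : lside G = Atom s -> Ls G = s.
Proof. destruct G as [SL SR]; simpl; now intros ->. Qed.

Lemma Rs_atom (G : game) (s : R) : rside G = Atom s -> Rs G = s.
Proof. destruct G as [SL SR]; simpl; now intros ->. Qed.

Lemma lopts_atom (G : game) (s : R) : lside G = Atom s -> lopts G = [].
Proof. unfold lopts; now intros ->. Qed.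

Lemma ropts_atom (G : game) (s : R) : rside G = Atom s -> ropts G = [].
Proof. unfold ropts; now intros ->. Qed.

(** * Sides of a disjunctive sum *)

Lemma in_lopts_add_l (G G' H : game) :
  In G' (lopts G) -> In (add_game G' H) (lopts (add_game G H)).
Proof.
  destruct G as [[a | g gs] SR], H as [[b | h hs] TR]; unfold lopts;
    simpl; rewrite ?in_app_iff, ?in_map_iff; try easy.
  - intros [<- | HG]; eauto.
  - intros [<- | HG]; eauto 6.
Qed.

Lemma in_lopts_add_r (G H H' : game) :
  In H' (lopts H) -> In (add_game G H') (lopts (add_game G H)).
Proof.
  destruct G as [[a | g gs] SR], H as [[b | h hs] TR]; unfold lopts;
    cbn -[In]; rewrite ?in_app_iff; try easy; fold add_game; simpl;
    rewrite ?in_app_iff; simpl; rewrite ?in_map_iff.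
  - intros [<- | HG]; eauto.
  - intros [<- | HG]; eauto 7.
Qed.

Lemma in_ropts_add_l (G G' H : game) :
  In G' (ropts G) -> In (add_game G' H) (ropts (add_game G H)).
Proof.
  destruct G as [SL [a | g gs]], H as [TL [b | h hs]]; unfold ropts;
    simpl; rewrite ?in_app_iff, ?in_map_iff; try easy.
  - intros [<- | HG]; eauto.
  - intros [<- | HG]; eauto 6.
Qed.

Lemma in_ropts_add_r (G H H' : game) :
  In H' (ropts H) -> In (add_game G H') (ropts (add_game G H)).
Proof.
  destruct G as [SL [a | g gs]], H as [TL [b | h hs]]; unfold ropts;
    cbn -[In]; rewrite ?in_app_iff; try easy; fold add_game; simpl;
    rewrite ?in_app_iff; simpl; rewrite ?in_map_iff.
  - intros [<- | HG]; eauto.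
  - intros [<- | HG]; eauto 7.
Qed.

Lemma lside_add (G H : game) (s t : R) :
  lside G = Atom s -> lside H = Atom t -> lside (add_game G H) = Atom (s + t).
Proof. destruct G, H; simpl; now intros -> ->. Qed.

Lemma rside_add (G H : game) (s t : R) :
  rside G = Atom s -> rside H = Atom t -> rside (add_game G H) = Atom (s + t).
Proof. destruct G, H; simpl; now intros -> ->. Qed.

(** * Atoms of followers *)

Definition atom_in (G : game) (s : R) : Prop :=
  exists K, follower G K /\ has_atom K s.

Lemma follower_trans (G H K : game) :
  follower G H -> follower H K -> follower G K.
Proof.
  intros GH HK; induction HK as [| A B HA IH | A B HA IH].
  - easy.
  - now apply follower_left with A.
  - now apply follower_right with A.
Qed.

(** [follower] grows by a last move; splitting off the first move instead is what recursion on
    options needs. *)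
Lemma follower_cases (G K : game) :
  follower G K ->
  K = G \/ (exists G', In G' (lopts G) /\ follower G' K) \/
  (exists G', In G' (ropts G) /\ follower G' K).
Proof.
  induction 1 as [| H K GH [-> | [(G' & I & F) | (G' & I & F)]] HK
                  | H K GH [-> | [(G' & I & F) | (G' & I & F)]] HK].
  - now left.
  - right; left; exists K; split; [easy | constructor].
  - right; left; exists G'; split; [easy | now apply follower_left with H].
  - right; right; exists G'; split; [easy | now apply follower_left with H].
  - right; right; exists K; split; [easy | constructor].
  - right; left; exists G'; split; [easy | now apply follower_right with H].
  - right; right; exists G'; split; [easy | now apply follower_right with H].
Qed.

Lemma atom_in_lside (G : game) (s : R) : lside G = Atom s -> atom_in G s.
Proof. intros E; exists G; split; [constructor | now left]. Qed.

Lemma atom_in_rside (G : game) (s : R) : rside G = Atom s -> atom_in G s.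
Proof. intros E; exists G; split; [constructor | now right]. Qed.

Lemma atom_in_lopts (G K : game) (s : R) :
  In K (lopts G) -> atom_in K s -> atom_in G s.
Proof.
  intros HK (H & F & A); exists H; split; [| easy].
  apply follower_trans with K; [| easy].
  apply follower_left with G; [constructor | easy].
Qed.

Lemma atom_in_ropts (G K : game) (s : R) :
  In K (ropts G) -> atom_in K s -> atom_in G s.
Proof.
  intros HK (H & F & A); exists H; split; [| easy].
  apply follower_trans with K; [| easy].
  apply follower_right with G; [constructor | easy].
Qed.

Lemma atom_in_cases (G : game) (s : R) :
  atom_in G s ->
  has_atom G s \/ (exists K, In K (lopts G) /\ atom_in K s) \/
  (exists K, In K (ropts G) /\ atom_in K s).
Proof.
  intros (K & F & A).
  destruct (follower_cases _ _ F) as [-> | [(G' & I & F') | (G' & I & F')]].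
  - now left.
  - right; left; exists G'; split; [easy | now exists K].
  - right; right; exists G'; split; [easy | now exists K].
Qed.

(** Play in the sum stops only where the player to move has an atom in both components, and these
    two are added. Bounds on atoms thus become bounds on scores. *)
Lemma score_add_atoms (G X : game) :
  (exists s t, atom_in G s /\ atom_in X t /\ Ls (add_game G X) = s + t) /\
  (exists s t, atom_in G s /\ atom_in X t /\ Rs (add_game G X) = s + t).
Proof.
  revert X; induction G as [G IGL IGR] using game_opts_ind.
  induction X as [X IXL IXR] using game_opts_ind; split.
  - destruct (Ls_cases (add_game G X)) as [E | (K & HK & E)].
    + apply lside_add_atom in E as (s & t & Es & Et & E).
      exists s, t; auto using atom_in_lside.
    + apply lopts_add in HK as [(K' & I & ->) | (K' & I & ->)].
      * destruct (IGL K' I X) as [_ (s & t & As & At & E')].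
        exists s, t; rewrite E; eauto using atom_in_lopts.
      * destruct (IXL K' I) as [_ (s & t & As & At & E')].
        exists s, t; rewrite E; eauto using atom_in_lopts.
  - destruct (Rs_cases (add_game G X)) as [E | (K & HK & E)].
    + apply rside_add_atom in E as (s & t & Es & Et & E).
      exists s, t; auto using atom_in_rside.
    + apply ropts_add in HK as [(K' & I & ->) | (K' & I & ->)].
      * destruct (IGR K' I X) as [(s & t & As & At & E') _].
        exists s, t; rewrite E; eauto using atom_in_ropts.
      * destruct (IXR K' I) as [(s & t & As & At & E') _].
        exists s, t; rewrite E; eauto using atom_in_ropts.
Qed.

(** * Guaranteed games *)

Lemma GS_lopts (G K : game) : GS G -> In K (lopts G) -> GS K.
Proof.
  intros HG HK H F; apply HG; apply follower_trans with K; [| easy].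
  apply follower_left with G; [constructor | easy].
Qed.

Lemma GS_ropts (G K : game) : GS G -> In K (ropts G) -> GS K.
Proof.
  intros HG HK H F; apply HG; apply follower_trans with K; [| easy].
  apply follower_right with G; [constructor | easy].
Qed.

(** With options on both sides the root is not atomic, so the guarantee is only tested further down.
    The distinguishing games built later have this shape and may therefore mix arbitrary guaranteed
    games. *)
Lemma GS_options (g h : game) (gs hs : list game) :
  (forall K, In K (g :: gs) -> GS K) -> (forall K, In K (h :: hs) -> GS K) ->
  GS (Game (Opts g gs) (Opts h hs)).
Proof.
  intros HL HR K F.
  destruct (follower_cases _ _ F) as [-> | [(G' & I & F') | (G' & I & F')]].
  - now intros [s [E | E]].
  - now apply (HL G' I).
  - now apply (HR G' I).
Qed.

Lemma GS_constant_atoms (G : game) (c : R) :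
  (forall s, atom_in G s -> s = c) -> GS G.
Proof.
  intros Hc K F _ s t Hs Ht.
  assert (HK : forall u, atom_in K u -> u = c).
  { intros u (H & F' & A); apply Hc; exists H; split; [| easy].
    now apply follower_trans with K. }
  rewrite (HK s), (HK t); [lra | |].
  - destruct Ht as [E | (A & B & I & F' & C)].
    + now apply atom_in_rside.
    + apply atom_in_ropts with A; [easy | now exists B].
  - destruct Hs as [E | (A & B & I & F' & C)].
    + now apply atom_in_lside.
    + apply atom_in_lopts with A; [easy | now exists B].
Qed.

Lemma GS_num_game (c : R) : GS (num_game c).
Proof.
  apply GS_constant_atoms with c; intros s A.
  destruct (atom_in_cases _ _ A) as [[E | E] | [(K & [] & _) | (K & [] & _)]];
    now injection E.
Qed.

Lemma atom_in_waiting (n : nat) (s : R) :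
  atom_in (conj_game (waiting n)) s -> s = 0.
Proof.
  induction n as [| n IH]; intros A;
    destruct (atom_in_cases _ _ A) as [[E | E] | [(K & I & A') | (K & I & A')]];
    try easy; try (injection E as <-; lra).
  destruct I as [<- | []]; auto.
Qed.

Lemma GS_waiting (n : nat) : GS (conj_game (waiting n)).
Proof. apply GS_constant_atoms with 0; apply atom_in_waiting. Qed.

Lemma lside_waiting (n : nat) : lside (conj_game (waiting n)) = Atom 0.
Proof. destruct n; simpl; f_equal; lra. Qed.

(** Left's side of G holds only the atom a, and every other atom occurring in G lies on Right's
    side, so the guarantee makes a the least of all. *)
Lemma GS_left_atom_le (G : game) (a t : R) :
  GS G -> lside G = Atom a -> atom_in G t -> a <= t.
Proof.
  intros HG E A.
  assert (HGG : guaranteed G) by (apply HG; [constructor | exists a; now left]).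
  destruct (atom_in_cases _ _ A) as [[E' | E'] | [(K & I & A') | (K & I & A')]].
  - rewrite E in E'; injection E'; lra.
  - apply HGG; now left.
  - now rewrite (lopts_atom _ _ E) in I.
  - apply HGG; [now left |].
    right; destruct A' as (H & F & C); now exists K, H.
Qed.

Lemma GS_right_atom_ge (G : game) (b t : R) :
  GS G -> rside G = Atom b -> atom_in G t -> t <= b.
Proof.
  intros HG E A.
  assert (HGG : guaranteed G) by (apply HG; [constructor | exists b; now right]).
  destruct (atom_in_cases _ _ A) as [[E' | E'] | [(K & I & A') | (K & I & A')]].
  - apply HGG; now left.
  - rewrite E in E'; injection E'; lra.
  - apply HGG; [| now left].
    right; destruct A' as (H & F & C); now exists K, H.
  - now rewrite (ropts_atom _ _ E) in I.
Qed.

(** * Translation by a number *)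

(** By [add_num_game] this is the sum with the number c; as a plain recursion it carries no second
    component through a proof. *)
Fixpoint shift (c : R) (G : game) : game :=
  match G with Game SL SR => Game (shift_side c SL) (shift_side c SR) end
with shift_side (c : R) (S : side) : side :=
  match S with
  | Atom s => Atom (s + c)
  | Opts g gs => Opts (shift c g) (map (shift c) gs)
  end.

Lemma lside_shift (c : R) (G : game) :
  lside (shift c G) = shift_side c (lside G).
Proof. now destruct G. Qed.

Lemma rside_shift (c : R) (G : game) :
  rside (shift c G) = shift_side c (rside G).
Proof. now destruct G. Qed.

Lemma lopts_shift (c : R) (G : game) :
  lopts (shift c G) = map (shift c) (lopts G).
Proof. unfold lopts; rewrite lside_shift; now destruct (lside G). Qed.

Lemma ropts_shift (c : R) (G : game) :
  ropts (shift c G) = map (shift c) (ropts G).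
Proof. unfold ropts; rewrite rside_shift; now destruct (rside G). Qed.

Lemma score_shift (c : R) (G : game) :
  Ls (shift c G) = Ls G + c /\ Rs (shift c G) = Rs G + c.
Proof.
  induction G as [G IHL IHR] using game_opts_ind; split.
  - destruct (Ls_cases G) as [E | (K & HK & E)].
    + apply Ls_atom; now rewrite lside_shift, E.
    + apply Rle_antisym.
      * destruct (Ls_cases (shift c G)) as [E' | (K' & HK' & E')].
        -- rewrite lside_shift in E'; unfold lopts in HK.
           now destruct (lside G).
        -- rewrite E'; rewrite lopts_shift in HK'.
           apply in_map_iff in HK' as (K'' & <- & I).
           rewrite (proj2 (IHL _ I)).
           pose proof (Rs_le_Ls _ _ I); lra.
      * rewrite E, <- (proj2 (IHL _ HK)); apply Rs_le_Ls.
        rewrite lopts_shift; now apply in_map.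
  - destruct (Rs_cases G) as [E | (K & HK & E)].
    + apply Rs_atom; now rewrite rside_shift, E.
    + apply Rle_antisym.
      * rewrite E, <- (proj1 (IHR _ HK)); apply Rs_le_Ls_right.
        rewrite ropts_shift; now apply in_map.
      * destruct (Rs_cases (shift c G)) as [E' | (K' & HK' & E')].
        -- rewrite rside_shift in E'; unfold ropts in HK.
           now destruct (rside G).
        -- rewrite E'; rewrite ropts_shift in HK'.
           apply in_map_iff in HK' as (K'' & <- & I).
           rewrite (proj1 (IHR _ I)).
           pose proof (Rs_le_Ls_right _ _ I); lra.
Qed.

Lemma Ls_shift (c : R) (G : game) : Ls (shift c G) = Ls G + c.
Proof. apply score_shift. Qed.

Lemma Rs_shift (c : R) (G : game) : Rs (shift c G) = Rs G + c.
Proof. apply score_shift. Qed.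

Lemma add_side_shift (c : R) (f g f' g' : game -> game) (S T : side) :
  (forall K, In K (options S) -> f' K = shift c (f K)) ->
  (forall K, In K (options T) -> g' (shift c K) = shift c (g K)) ->
  add_side f' g' S (shift_side c T) = shift_side c (add_side f g S T).
Proof.
  destruct S as [s | h hs], T as [t | k ks]; simpl; intros Hf Hg.
  - f_equal; lra.
  - rewrite !map_map, Hg by (now left). f_equal.
    apply map_ext_in; intros K HK; apply Hg; now right.
  - rewrite !map_map, Hf by (now left). f_equal.
    apply map_ext_in; intros K HK; apply Hf; now right.
  - rewrite map_app; simpl; rewrite !map_map, Hf, Hg by now left.
    f_equal; f_equal; [| f_equal]; apply map_ext_in; intros K HK;
      [apply Hf | apply Hg]; now right.
Qed.

Lemma add_shift (c : R) (G X : game) :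
  add_game G (shift c X) = shift c (add_game G X).
Proof.
  revert X; induction G as [G IGL IGR] using game_opts_ind.
  induction X as [X IXL IXR] using game_opts_ind.
  destruct G as [GL GR], X as [XL XR]; simpl; f_equal;
    apply add_side_shift.
  - intros K HK; exact (IGL K HK (Game XL XR)).
  - intros K HK; exact (IXL K HK).
  - intros K HK; exact (IGR K HK (Game XL XR)).
  - intros K HK; exact (IXR K HK).
Qed.

Lemma add_num_game (l : R) (X : game) : add_game (num_game l) X = shift l X.
Proof.
  assert (side_eq : forall f g S,
    (forall K, In K (options S) -> g K = shift l K) ->
    add_side f g (Atom l) S = shift_side l S).
  { intros f g [s | h hs] Hg; simpl; [f_equal; lra |].
    rewrite Hg by (now left). f_equal.
    apply map_ext_in; intros K HK; apply Hg; now right. }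
  induction X as [[XL XR] IHL IHR] using game_opts_ind.
  (* The first function acts on options of the number, which has none; the identity fills the
     slot. *)
  simpl; f_equal; apply (side_eq (fun K => K)).
  - exact IHL.
  - exact IHR.
Qed.

Lemma shift_num_game (c : R) : shift c (num_game 0) = num_game c.
Proof. unfold num_game; simpl; now rewrite Rplus_0_l. Qed.

Lemma follower_shift (c : R) (G K : game) :
  follower (shift c G) K -> exists K', follower G K' /\ K = shift c K'.
Proof.
  induction 1 as [| H K F (H' & F' & ->) I | H K F (H' & F' & ->) I].
  - exists G; split; [constructor | easy].
  - rewrite lopts_shift in I; apply in_map_iff in I as (K' & <- & I).
    exists K'; split; [now apply follower_left with H' | easy].
  - rewrite ropts_shift in I; apply in_map_iff in I as (K' & <- & I).
    exists K'; split; [now apply follower_right with H' | easy].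
Qed.

Lemma shift_side_atom (c s : R) (S : side) :
  shift_side c S = Atom s -> S = Atom (s - c).
Proof. destruct S; simpl; [intros E; injection E as <-; f_equal; lra | easy]. Qed.

Lemma has_atom_shift (c s : R) (G : game) :
  has_atom (shift c G) s -> has_atom G (s - c).
Proof.
  unfold has_atom; rewrite lside_shift, rside_shift.
  intros [E | E]; apply shift_side_atom in E; auto.
Qed.

Lemma GS_shift (c : R) (G : game) : GS G -> GS (shift c G).
Proof.
  intros HG K F [u A] s t Hs Ht.
  apply follower_shift in F as (K' & F & ->).
  enough (s - c <= t - c) by lra.
  apply (HG K' F).
  - exists (u - c); now apply has_atom_shift.
  - destruct Hs as [E | (B & C & I & F' & HC)].
    + left; rewrite lside_shift in E; now apply shift_side_atom.
    + right; rewrite lopts_shift in I; apply in_map_iff in I as (B' & <- & I).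
      apply follower_shift in F' as (C' & F' & ->).
      exists B', C'; auto using has_atom_shift.
  - destruct Ht as [E | (B & C & I & F' & HC)].
    + left; rewrite rside_shift in E; now apply shift_side_atom.
    + right; rewrite ropts_shift in I; apply in_map_iff in I as (B' & <- & I).
      apply follower_shift in F' as (C' & F' & ->).
      exists B', C'; auto using has_atom_shift.
Qed.

(** * Protected games dominate *)

(* With n at least the number of moves Right can make in X, Right does no
   better in G + X than with n passes, up to the least atom s of X. *)
Lemma waiting_bound (X : game) (s : R) :
  (forall t, atom_in X t -> s <= t) ->
  exists N, forall n, (N <= n)%nat -> forall G, GS G ->
    Ls (add_game G (conj_game (waiting n))) + s <= Ls (add_game G X) /\
    Rs (add_game G (conj_game (waiting n))) + s <= Rs (add_game G X).
Proof.
  induction X as [X _ IX] using game_opts_ind; intros HX.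
  (* The maximum over the Right options gives one bound valid after every first move of Right in
     X. *)
  assert (HN : exists N, forall K, In K (ropts X) ->
    forall n, (N <= n)%nat -> forall G, GS G ->
    Ls (add_game G (conj_game (waiting n))) + s <= Ls (add_game G K)).
  { assert (HK : forall K, In K (ropts X) -> exists N,
      forall n, (N <= n)%nat -> forall G, GS G ->
      Ls (add_game G (conj_game (waiting n))) + s <= Ls (add_game G K)).
    { intros K HK; destruct (IX K HK) as [N HN].
      - intros t A; apply HX; now apply atom_in_ropts with K.
      - exists N; intros n Hn G HG; now apply HN. }
    clear IX; induction (ropts X) as [| g gs IH]; [now exists 0%nat |].
    destruct IH as [N1 H1]; [intros; apply HK; now right |].
    destruct (HK g) as [N2 H2]; [now left |].
    exists (Nat.max N1 N2); intros K [<- | I] n Hn G HG;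
      [apply H2 | apply H1]; trivial; lia. }
  (* The extra pass pays for that first move. With n fixed, induction on G lets moves in G be copied
     between the two sums. *)
  destruct HN as [N HN]; exists (S N); intros n Hn.
  induction G as [G IGL IGR] using game_opts_ind; intros HG; split.
  - destruct (Ls_cases (add_game G (conj_game (waiting n))))
      as [E | (K & HK & E)].
    (* Left is out of moves in G, with least atom a, and the passes contribute 0; any score of G + X
       is at least a + s. *)
    + apply lside_add_atom in E as (a & z & Ea & Ez & ->).
      rewrite lside_waiting in Ez; injection Ez as <-.
      destruct (score_add_atoms G X) as [(b & t & Ab & At & ->) _].
      pose proof (GS_left_atom_le _ _ _ HG Ea Ab).
      pose proof (HX t At); lra.
    + apply lopts_add in HK as [(K' & I & ->) | (K' & I & ->)].
      * rewrite E; eapply Rle_trans.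
        -- apply IGL; [exact I | now apply GS_lopts with G].
        -- apply Rs_le_Ls; now apply in_lopts_add_l.
      * now rewrite (lopts_atom _ _ (lside_waiting n)) in I.
  - destruct (Rs_cases (add_game G X)) as [E | (K & HK & E)].
    (* Right is out of moves in G, so b is the greatest atom of G and bounds its score against the
       passes. *)
    + apply rside_add_atom in E as (b & t & Eb & Et & ->).
      destruct (score_add_atoms G (conj_game (waiting n)))
        as [_ (a & z & Aa & Az & ->)].
      apply atom_in_waiting in Az as ->.
      pose proof (GS_right_atom_ge _ _ _ HG Eb Aa).
      pose proof (HX t (atom_in_rside _ _ Et)); lra.
    + rewrite E; apply ropts_add in HK as [(K' & I & ->) | (K' & I & ->)].
      * apply Rle_trans with (Ls (add_game K' (conj_game (waiting n))) + s).
        -- apply Rplus_le_compat_r, Rs_le_Ls_right; now apply in_ropts_add_l.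
        -- apply IGR; [exact I | now apply GS_ropts with G].
      (* Right's move in X is matched by spending one pass, which leaves at least N of them. *)
      * destruct n as [| n]; [lia |].
        apply Rle_trans with (Ls (add_game G (conj_game (waiting n))) + s).
        -- apply Rplus_le_compat_r, Rs_le_Ls_right, in_ropts_add_r; now left.
        -- apply HN; trivial; lia.
Qed.

Lemma left_protected_pass (G : game) (l : R) (n : nat) :
  left_protected l G -> l <= Ls (add_game G (conj_game (waiting n))).
Proof.
  intros [HP _]; destruct (pass_Ls_is_min G) as [_ Hmin].
  apply Rle_trans with (pass_Ls G); [lra |].
  apply Hmin; now exists n.
Qed.

(** A Right atom of G is its greatest atom, so it bounds the Left score of G with no passes, which
    protection puts at l or more. *)
Lemma left_protected_right_atom (G : game) (l r : R) :
  GS G -> left_protected l G -> rside G = Atom r -> l <= r.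
Proof.
  intros HG HP E.
  eapply Rle_trans; [apply (left_protected_pass _ _ 0 HP) |].
  destruct (score_add_atoms G (conj_game (waiting 0)))
    as [(a & z & Aa & Az & ->) _].
  apply atom_in_waiting in Az as ->.
  pose proof (GS_right_atom_ge _ _ _ HG E Aa); lra.
Qed.

(** The outer induction on G supplies the positions G^RL with every X; the inner one supplies the
    options of X with the same G. *)
Lemma left_protected_score (G : game) (l : R) :
  GS G -> left_protected l G -> forall X, GS X ->
  Ls X + l <= Ls (add_game G X) /\ Rs X + l <= Rs (add_game G X).
Proof.
  induction G as [G IG] using game_rl_ind; intros HG HP.
  induction X as [X IXL IXR] using game_opts_ind; intros HX; split.
  - destruct (Ls_cases X) as [E | (K & HK & E)].
    (* The Left atom of X is its least atom, so it can serve as the lower bound s. *)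
    + destruct (waiting_bound X (Ls X)) as [N HN].
      { intros t A; now apply GS_left_atom_le with X. }
      destruct (HN N (le_n N) G HG) as [HL _].
      pose proof (left_protected_pass _ _ N HP); lra.
    + rewrite E; eapply Rle_trans.
      * apply IXL; [exact HK | now apply GS_lopts with X].
      * apply Rs_le_Ls; now apply in_lopts_add_r.
  - destruct (Rs_cases (add_game G X)) as [E | (K & HK & E)].
    + apply rside_add_atom in E as (r & t & Er & Et & ->).
      rewrite (Rs_atom _ _ Et).
      pose proof (left_protected_right_atom _ _ _ HG HP Er); lra.
    + rewrite E; apply ropts_add in HK as [(GR & I & ->) | (K' & I & ->)].
      (* The protected reply G^RL returns the turn to Right with X unchanged. *)
      * destruct HP as [_ HP]; destruct (HP GR I) as (GRL & I' & HP').
        apply Rle_trans with (Rs (add_game GRL X)).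
        -- apply (IG GR GRL I I'); trivial.
           apply GS_lopts with GR; [now apply GS_ropts with G | easy].
        -- apply Rs_le_Ls; now apply in_lopts_add_l.
      * pose proof (Rs_le_Ls_right _ _ I).
        destruct (IXR K' I) as [HL _]; [now apply GS_ropts with X | lra].
Qed.

(** * Dominating games are protected *)

(* A failure with Right to move, in Y, becomes one with Left to move: offer Left
   the move to Y under a Right threat so large that any other Left move loses. *)
Lemma not_game_ge_Ls (G : game) (l : R) :
  ~ game_ge G (num_game l) ->
  exists X, GS X /\ Ls (add_game G X) < Ls X + l.
Proof.
  intros HG; apply not_all_ex_not in HG as [Y HY].
  apply imply_to_and in HY as [GY HY].
  rewrite !add_num_game, Ls_shift, Rs_shift in HY.
  destruct (Rlt_dec (Ls (add_game G Y)) (Ls Y + l)) as [HL | HL];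
    [now exists Y |].
  assert (HR : Rs (add_game G Y) < Rs Y + l) by (apply Rnot_le_lt; intros ?; lra).
  (* The sum with 0 is kept so that [add_shift] can later turn 0 into c. *)
  destruct (exists_upper_bound (fun K => Ls (add_game K (num_game 0))) (lopts G))
    as [B HB].
  (* If Left moves in G, Right's threat c holds the outcome to at most B + c, one below the target
     Rs Y + l. *)
  set (c := Rs Y + l - B - 1).
  exists (Game (Opts Y []) (Opts (num_game c) [])); split.
  - apply GS_options; intros K [<- | []]; [easy | apply GS_num_game].
  - change (Ls (Game (Opts Y []) (Opts (num_game c) []))) with (Rs Y).
    set (X := Game (Opts Y []) (Opts (num_game c) [])).
    destruct (Ls_cases (add_game G X)) as [E | (K & HK & E)].
    { now apply lside_add_atom in E as (s & t & _ & E & _). }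
    rewrite E; apply lopts_add in HK as [(K' & I & ->) | (K' & [<- | []] & ->)];
      [| easy].
    apply Rle_lt_trans with (Ls (add_game K' (num_game c))).
    + apply Rs_le_Ls_right, in_ropts_add_r; now left.
    + rewrite <- shift_num_game, add_shift, Ls_shift.
      pose proof (HB K' I); unfold c; lra.
Qed.

(** Translating a witness changes both sides of its strict inequality equally. A common Left score
    means that offering all witnesses to Right gives a game whose Right score is known exactly. *)
Lemma normalised_witnesses (l : R) (gs : list game) :
  (forall K, In K gs -> ~ game_ge K (num_game l)) ->
  exists Xs, (forall X, In X Xs -> GS X /\ Ls X = - l) /\
    forall K, In K gs -> exists X, In X Xs /\ Ls (add_game K X) < 0.
Proof.
  induction gs as [| g gs IH]; intros Hgs; [now exists [] |].
  destruct IH as (Xs & HXs & Hlt); [intros; apply Hgs; now right |].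
  destruct (not_game_ge_Ls g l) as (X & GX & HX); [apply Hgs; now left |].
  exists (shift (- l - Ls X) X :: Xs); split.
  - intros Y [<- | I]; [| auto].
    split; [now apply GS_shift | rewrite Ls_shift; lra].
  - intros K [<- | I].
    + exists (shift (- l - Ls X) X); split; [now left |].
      rewrite add_shift, Ls_shift; lra.
    + destruct (Hlt K I) as (Y & IY & HY); exists Y; split; [now right | easy].
Qed.

Lemma game_ge_reply (G GR : game) (l : R) :
  game_ge G (num_game l) -> In GR (ropts G) ->
  exists GRL, In GRL (lopts GR) /\ game_ge GRL (num_game l).
Proof.
  intros HG HR; apply NNPP; intros Hno.
  destruct (normalised_witnesses l (lopts GR)) as (Xs & HXs & Hlt).
  { intros K I HK; apply Hno; now exists K. }
  (* Chosen so that Left's move from GR + X to GR + c scores exactly -1. *)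
  set (c := - Rs (add_game GR (num_game 0)) - 1).
  (* The option -l keeps Right's side nonempty even if GR has no Left option, and it shares the Left
     score of the witnesses. *)
  set (X := Game (Opts (num_game c) []) (Opts (num_game (- l)) Xs)).
  assert (GX : GS X).
  { apply GS_options.
    - intros K [<- | []]; apply GS_num_game.
    - intros K [<- | I]; [apply GS_num_game | now apply HXs]. }
  assert (RX : Rs X = - l).
  { destruct (Rs_cases X) as [E | (K & [<- | I] & ->)]; [easy | easy |].
    now apply HXs. }
  destruct (HG X GX) as [_ H]; revert H.
  rewrite add_num_game, Rs_shift, RX; apply Rlt_not_ge.
  replace (- l + l) with 0 by lra.
  (* Right opens with GR; every Left continuation must then fall below 0. *)
  apply Rle_lt_trans with (Ls (add_game GR X)).
  { apply Rs_le_Ls_right; now apply in_ropts_add_l. }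
  destruct (Ls_cases (add_game GR X)) as [E | (K & HK & ->)].
  { now apply lside_add_atom in E as (s & t & _ & E & _). }
  apply lopts_add in HK as [(K' & I & ->) | (K' & [<- | []] & ->)].
  (* Right answers the reply K' by moving in X to its witness Y. *)
  - destruct (Hlt K' I) as (Y & IY & HY).
    apply Rle_lt_trans with (Ls (add_game K' Y)); [| easy].
    apply Rs_le_Ls_right, in_ropts_add_r; now right.
  - rewrite <- shift_num_game, add_shift, Rs_shift; unfold c; lra.
Qed.

(** The minimum is attained at some number of passes, and those passes form a guaranteed test game
    with Left atom 0. *)
Lemma game_ge_pass (G : game) (l : R) :
  game_ge G (num_game l) -> pass_Ls G >= l.
Proof.
  intros HG; destruct (pass_Ls_is_min G) as [[n ->] _].
  destruct (HG _ (GS_waiting n)) as [H _].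
  rewrite add_num_game, Ls_shift, (Ls_atom _ _ (lside_waiting n)) in H; lra.
Qed.

Lemma game_ge_left_protected (G : game) (l : R) :
  game_ge G (num_game l) -> left_protected l G.
Proof.
  induction G as [G IG] using game_rl_ind; intros HG.
  constructor; [now apply game_ge_pass |].
  intros GR HR; destruct (game_ge_reply _ _ _ HG HR) as (GRL & HL & Hge).
  exists GRL; split; [easy | now apply (IG GR)].
Qed.

Theorem theorem4 (G : game) (l : R) (hG : GS G) :
  game_ge G (num_game l) <-> left_protected l G.
Proof.
  split; [apply game_ge_left_protected |].
  intros HP X HX; rewrite add_num_game, Ls_shift, Rs_shift.
  destruct (left_protected_score G l hG HP X HX); lra.
Qed.
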